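(* Let $\Bbbk$ be an algebraically closed field of characteristic $p>2$ and let $D(H)$ be the Drinfeld double of the bosonization $H$ of the restricted Jordan plane. There are exactly $p$ isomorphism classes of simple $D(H)$-modules, which have dimensions $1,2,\dots,p$.
   Context: $H$ is the $p^3$-dimensional Hopf algebra generated by $x,y,g$ with relations $g^p=1$, $gx=xg$, $gy=yg+xg$, $x^p=0$, $y^p=0$, $yx=xy-\frac12x^2$ and coproduct $\Delta(g)=g\otimes g$, $\Delta(x)=x\otimes1+g\otimes x$, $\Delta(y)=y\otimes1+g\otimes y$. Its Drinfeld double $D(H)$, of dimension $p^6$, is the Hopf algebra presented as an algebra by generators $u,v,\zeta,g,x,y$ and relations \begin{align*} & g^p=1,\ gx=xg,\ gy=yg+xg,\ x^p=0,\ y^p=0,\ yx=xy-\tfrac12x^2,\ \zeta^p=\zeta,\ g\zeta=\zeta g,\\ & v^p=0,\ u^p=0,\ vu=uv-\tfrac12u^2,\ v\zeta=\zeta v+v,\ u\zeta=\zeta u+u,\\ & \zeta y=y\zeta+y,\ \zeta x=x\zeta+x,\ vg=gv+gu,\ ug=gu,\ vx=xv+(1-g)+xu,\\ & ux=xu,\ uy=yu+(1-g),\ vy=yv-g\zeta+yu. \end{align*} *)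

(* Defs.v *)
From HB Require Import structures.
From mathcomp Require Import all_boot all_order all_algebra.
From mathcomp Require Import finmap monalg boolp.

Set Implicit Arguments.
Unset Strict Implicit.
Unset Printing Implicit Defensive.

Import GRing.Theory.

Local Open Scope ring_scope.
Local Open Scope quotient_scope.

Section TwoSidedIdeal.
Context (R : nzRingType) (r : seq R).

Inductive in_ideal : R -> Prop :=
| in_ideal0 : in_ideal 0
| in_ideal_gen a : a \in r -> in_ideal a
| in_idealD a b : in_ideal a -> in_ideal b -> in_ideal (a + b)
| in_idealMl c a : in_ideal a -> in_ideal (c * a)
| in_idealMr c a : in_ideal a -> in_ideal (a * c).

Definition ideal_gen : {pred R} := fun a => `[< in_ideal a >].

Lemma ideal_genP a : reflect (in_ideal a) (a \in ideal_gen).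
Proof. exact: asboolP. Qed.

Lemma ideal_gen_zmod_closed : zmod_closed ideal_gen.
Proof.
split=> [|a b /ideal_genP Ia /ideal_genP Ib]; apply/ideal_genP.
  exact: in_ideal0.
by rewrite -mulN1r; apply: in_idealD => //; apply: in_idealMl.
Qed.

HB.instance Definition _ := GRing.isZmodClosed.Build R ideal_gen
  ideal_gen_zmod_closed.

End TwoSidedIdeal.

Section QuotientAlgebra.
Context (k : fieldType) (A : algType k) (r : seq A).

(* The properness proof is an argument of the type because mathcomp algebras  *)
(* are nontrivial rings.                                                      *)
Definition quot_alg (_ : 1 \notin ideal_gen r) : Type :=
  Quotient.quot (ideal_gen r).

Context (r_proper : 1 \notin ideal_gen r).
Local Notation Q := (quot_alg r_proper).

HB.instance Definition _ := GRing.Zmodule.on Q.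

Definition qpi (a : A) : Q := \pi_(Quotient.quot (ideal_gen r)) a.
Definition qrepr (q : Q) : A := repr (q : Quotient.quot (ideal_gen r)).

Lemma qreprK : cancel qrepr qpi. Proof. exact: reprK. Qed.

Lemma qpi_eq a b : (qpi a = qpi b) <-> (a - b \in ideal_gen r).
Proof. by rewrite Quotient.idealrBE; split=> /eqP. Qed.

Lemma qpi_reprB a : qrepr (qpi a) - a \in ideal_gen r.
Proof. by apply/qpi_eq; rewrite qreprK. Qed.

Lemma qpi0 : qpi 0 = 0. Proof. exact: raddf0. Qed.

Lemma qpiD : {morph qpi : a b / a + b}.
Proof. exact: (raddfD (\pi_(Quotient.quot (ideal_gen r)))). Qed.

Definition quot_mul (x y : Q) : Q := qpi (qrepr x * qrepr y).
Definition quot_scale (c : k) (x : Q) : Q := qpi (c *: qrepr x).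

Lemma qpiM a b : qpi (a * b) = quot_mul (qpi a) (qpi b).
Proof.
apply/qpi_eq; have /ideal_genP Ia := qpi_reprB a.
have /ideal_genP Ib := qpi_reprB b; apply/ideal_genP.
set a' := qrepr _ in Ia *; set b' := qrepr _ in Ib *.
have -> : a * b - a' * b' = - 1 * ((a' - a) * b') + (- a) * (b' - b).
  by rewrite mulN1r mulrBl opprB mulNr mulrBr opprB addrAC subrKC addrC.
by apply: in_idealD; apply: in_idealMl => //; apply: in_idealMr.
Qed.

Lemma qpiZ c a : qpi (c *: a) = quot_scale c (qpi a).
Proof.
rewrite -mulr_algl qpiM /quot_scale -[c *: qrepr _]mulr_algl qpiM.
by rewrite qreprK.
Qed.

Lemma quot_mulA : associative quot_mul.
Proof.
move=> x y z; rewrite -[x]qreprK -[y]qreprK -[z]qreprK.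
by rewrite -!qpiM mulrA.
Qed.

Lemma quot_mul1 : left_id (qpi 1) quot_mul.
Proof. by move=> x; rewrite -[x]qreprK -qpiM mul1r. Qed.

Lemma quot_mulr1 : right_id (qpi 1) quot_mul.
Proof. by move=> x; rewrite -[x]qreprK -qpiM mulr1. Qed.

Lemma quot_mulDl : left_distributive quot_mul +%R.
Proof.
move=> x y z; rewrite -[x]qreprK -[y]qreprK -[z]qreprK.
by rewrite -qpiD -!qpiM mulrDl qpiD.
Qed.

Lemma quot_mulDr : right_distributive quot_mul +%R.
Proof.
move=> x y z; rewrite -[x]qreprK -[y]qreprK -[z]qreprK.
by rewrite -qpiD -!qpiM mulrDr qpiD.
Qed.

Lemma quot_1_neq0 : qpi 1 != 0.
Proof. by rewrite -qpi0; apply/eqP => /qpi_eq; rewrite subr0; apply/negP. Qed.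

HB.instance Definition _ := GRing.Zmodule_isNzRing.Build Q
  quot_mulA quot_mul1 quot_mulr1 quot_mulDl quot_mulDr quot_1_neq0.

Lemma quot_scaleA a b x : quot_scale a (quot_scale b x) = quot_scale (a * b) x.
Proof. by rewrite -[x]qreprK -!qpiZ scalerA. Qed.

Lemma quot_scale1 : left_id 1 quot_scale.
Proof. by move=> x; rewrite -[x]qreprK -qpiZ scale1r. Qed.

Lemma quot_scaleDr : right_distributive quot_scale +%R.
Proof.
by move=> c x y; rewrite -[x]qreprK -[y]qreprK -qpiD -!qpiZ scalerDr qpiD.
Qed.

Lemma quot_scaleDl x : {morph quot_scale^~ x : a b / a + b}.
Proof. by move=> a b; rewrite -[x]qreprK -!qpiZ scalerDl qpiD. Qed.

HB.instance Definition _ := GRing.Zmodule_isLmodule.Build k Q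
  quot_scaleA quot_scale1 quot_scaleDr quot_scaleDl.

Lemma quot_scaleAl (c : k) (x y : Q) : c *: (x * y) = (c *: x) * y.
Proof.
rewrite -[x]qreprK -[y]qreprK.
have M a b : qpi a * qpi b = qpi (a * b) by rewrite qpiM.
have Z a : c *: qpi a = qpi (c *: a) by rewrite qpiZ.
by rewrite !(M, Z) scalerAl.
Qed.

HB.instance Definition _ := GRing.Lmodule_isLalgebra.Build k Q quot_scaleAl.

Lemma quot_scaleAr (c : k) (x y : Q) : c *: (x * y) = x * (c *: y).
Proof.
rewrite -[x]qreprK -[y]qreprK.
have M a b : qpi a * qpi b = qpi (a * b) by rewrite qpiM.
have Z a : c *: qpi a = qpi (c *: a) by rewrite qpiZ.
by rewrite !(M, Z) scalerAr.
Qed.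

HB.instance Definition _ := GRing.Lalgebra_isAlgebra.Build k Q quot_scaleAr.

End QuotientAlgebra.

Section FreeAlgebra.
Context (k : fieldType) (I : choiceType).

Lemma malg_scaleAr (c : k) (a b : {malg k[{fmonom I}]}) :
  c *: (a * b) = a * (c *: b).
Proof.
apply/malgP=> m.
rewrite mcoeffZ mcoeffMl (mcoeffMlw _ (fsubset_refl _) (msuppZ_le c b)).
rewrite mulr_sumr; apply: eq_bigr => m1 _; rewrite mulr_sumr.
by apply: eq_bigr => m2 _; rewrite mcoeffZ mulrnAr mulrCA.
Qed.

Definition free_alg : Type := {malg k[{fmonom I}]}.

HB.instance Definition _ := GRing.Lalgebra.on free_alg.
HB.instance Definition _ :=
  GRing.Lalgebra_isAlgebra.Build k free_alg malg_scaleAr.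

Definition free_gen (i : I) : free_alg := << fmu i >>.

Section Eval.
Context (f : I -> k).

Definition word_eval (m : {fmonom I}) : k := \prod_(i <- m) f i.

Lemma word_eval_mmorphism : mmorphism word_eval.
Proof.
by split=> [m1 m2|]; rewrite /word_eval ?fmM ?fm1 ?big_nil ?big_cat.
Qed.

HB.instance Definition _ :=
  isMultiplicative.Build _ _ word_eval word_eval_mmorphism.

Definition free_eval (a : free_alg) : k := mmap idfun word_eval a.

Lemma free_eval1 : free_eval 1 = 1. Proof. exact: rmorph1. Qed.
Lemma free_evalD : {morph free_eval : a b / a + b}. Proof. exact: rmorphD. Qed.
Lemma free_evalB : {morph free_eval : a b / a - b}. Proof. exact: rmorphB. Qed.
Lemma free_evalM : {morph free_eval : a b / a * b}. Proof. exact: rmorphM. Qed.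
Lemma free_evalX n : {morph free_eval : a / a ^+ n}. Proof. exact: rmorphXn. Qed.

Lemma free_eval_gen i : free_eval (free_gen i) = f i.
Proof. by rewrite /free_eval mmapU mul1r /word_eval fmU big_seq1. Qed.

Lemma free_evalZ c a : free_eval (c *: a) = c * free_eval a.
Proof. exact: mmapZ. Qed.

Lemma free_eval_proper (r : seq free_alg) :
  {in r, forall a, free_eval a = 0} -> 1 \notin ideal_gen r.
Proof.
move=> r0; apply/ideal_genP => I1.
have: free_eval 1 = 0.
  elim: I1 => [|a /r0//|a b _ Ha _ Hb|c a _ Ha|c a _ Ha].
  - exact: (raddf0 (mmap idfun (word_eval))).
  - by rewrite free_evalD Ha Hb addr0.
  - by rewrite free_evalM Ha mulr0.
  - by rewrite free_evalM Ha mul0r.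
by rewrite free_eval1 => /eqP; rewrite oner_eq0.
Qed.

End Eval.
End FreeAlgebra.

Variant dh_gen := Gu | Gv | Gzeta | Gg | Gx | Gy.

Definition dh_gen_code (a : dh_gen) : nat :=
  match a with
  | Gu => 0 | Gv => 1 | Gzeta => 2 | Gg => 3 | Gx => 4 | Gy => 5
  end.
Definition dh_gen_decode (n : nat) : dh_gen :=
  nth Gu [:: Gu; Gv; Gzeta; Gg; Gx; Gy] n.
Lemma dh_gen_codeK : cancel dh_gen_code dh_gen_decode. Proof. by case. Qed.
HB.instance Definition _ := Countable.copy dh_gen (can_type dh_gen_codeK).

Section DrinfeldDouble.
Context (k : fieldType) (p : nat).

Definition dh_eqns (A : algType k) (u v zeta g x y : A) : seq (A * A) :=
  [:: (g ^+ p, 1);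
      (g * x, x * g);
      (g * y, y * g + x * g);
      (x ^+ p, 0);
      (y ^+ p, 0);
      (y * x, x * y - 2%:R^-1 *: x ^+ 2);
      (zeta ^+ p, zeta);
      (g * zeta, zeta * g);
      (v ^+ p, 0);
      (u ^+ p, 0);
      (v * u, u * v - 2%:R^-1 *: u ^+ 2);
      (v * zeta, zeta * v + v);
      (u * zeta, zeta * u + u);
      (zeta * y, y * zeta + y);
      (zeta * x, x * zeta + x);
      (v * g, g * v + g * u);
      (u * g, g * u);
      (v * x, x * v + (1 - g) + x * u);
      (u * x, x * u);
      (u * y, y * u + (1 - g));
      (v * y, y * v - g * zeta + y * u)].

Definition dh_rels : seq (free_alg k dh_gen) :=
  [seq e.1 - e.2 | e <- dh_eqns
     (free_gen k Gu) (free_gen k Gv) (free_gen k Gzeta)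
     (free_gen k Gg) (free_gen k Gx) (free_gen k Gy)].

Lemma dh_eqns_counit (A : algType k) (ev : A -> k) (u v zeta g x y : A) :
    {morph ev : a b / a + b} -> {morph ev : a b / a - b} ->
    {morph ev : a b / a * b} -> ev 1 = 1 ->
    (forall c a, ev (c *: a) = c * ev a) -> (0 < p)%N ->
    ev g = 1 -> [/\ ev u = 0, ev v = 0, ev zeta = 0, ev x = 0 & ev y = 0] ->
  {in [seq e.1 - e.2 | e <- dh_eqns u v zeta g x y], forall a, ev a = 0}.
Proof.
move=> evD evB evM ev1 evZ p_gt0 evg [eu ev_v ez ex ey].
have evX n a : ev (a ^+ n) = ev a ^+ n.
  by elim: n => [|n IHn]; rewrite ?expr0 // !exprS evM IHn.
have ev_0 : ev 0 = 0 by rewrite -(subrr 0) evB subrr.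
have p0 : (p == 0)%N = false by rewrite eqn0Ngt p_gt0.
suff: all (fun a => ev a == 0) [seq e.1 - e.2 | e <- dh_eqns u v zeta g x y].
  by move=> /allP H a /H /eqP.
rewrite /=; do ![apply/andP; split]; rewrite // !(evB, evD, evM, evX, evZ) //.
all: rewrite ?(ev1, ev_0, evg, eu, ev_v, ez, ex, ey) ?expr1n ?expr0n ?p0.
all: by rewrite ?(mulr0, mul0r, mul1r, mulr1, addr0, subrr, oppr0).
Qed.

Lemma dh_rels_proper : p \in [pchar k] -> 1 \notin ideal_gen dh_rels.
Proof.
move=> /pcharf_prime /prime_gt0 p_gt0.
pose counit a : k := if a is Gg then 1 else 0.
apply: (@free_eval_proper _ _ counit); apply: dh_eqns_counit => //.
- exact: free_evalD.
- exact: free_evalB.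
- exact: free_evalM.
- exact: free_eval1.
- exact: free_evalZ.
- exact: free_eval_gen.
by split; apply: free_eval_gen.
Qed.

End DrinfeldDouble.

(* The Drinfeld double of the bosonization of the restricted Jordan plane,    *)
(* as an algebra: the free algebra on dh_gen modulo the two-sided ideal       *)
(* generated by the differences of the two sides of the equations dh_eqns.    *)
Definition DH (k : fieldType) (p : nat) (pchar_k : p \in [pchar k]) : Type :=
  quot_alg (dh_rels_proper pchar_k).

HB.instance Definition _ (k : fieldType) (p : nat) (pchar_k : p \in [pchar k]) :=
  GRing.Algebra.on (DH pchar_k).

(* Submodules are given by boolean predicates; with the classical axioms of   *)
(* boolp these are all the submodules.                                        *)
Definition simple_module (R : nzRingType) (M : lmodType R) : Prop :=
  (exists m : M, m != 0) /\
  forall S : {pred M}, submod_closed S -> (S =i pred1 0) \/ (S =i predT).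

Definition isomorphic_modules (R : nzRingType) (M N : lmodType R) : Prop :=
  exists f : {linear M -> N}, bijective f.

(* Dimension over k of a module over a k-algebra A: k acts on M through the   *)
(* structure map in_alg A : k -> A, and M is k-linearly isomorphic to k^n.    *)
Definition has_dim (k : fieldType) (A : algType k) (M : lmodType A) (n : nat) :
    Prop :=
  exists f : {linear 'rV[k]_n -> M | in_alg A \; *:%R}, bijective f.

(* Main.v *)
From HB Require Import structures.
Require Import Defs.
From mathcomp Require Import all_boot all_order all_algebra.
From mathcomp Require Import finmap monalg boolp ring.

Set Implicit Arguments.
Unset Strict Implicit.
Unset Printing Implicit Defensive.

Import GRing.Theory.
Local Open Scope ring_scope.

(** In a simple D(H)-module M the commuting elements x, u and g - 1 are
    nilpotent, so some nonzero vector is killed by all three. The vectors killed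
    by all three form a submodule, because every commutator of x, u or g - 1
    with a generator is a combination of words ending in x, u or g - 1; hence x,
    u and g - 1 act by zero on all of M ([simple_augmented]). What is left of
    the relations on M is

      y^p = v^p = 0,  zeta^p = zeta,  [zeta, y] = y,  [zeta, v] = - v,
      [y, v] = zeta,

    the restricted enveloping algebra of sl2 with e = y, f = 2v and h = 2 zeta,
    and the rest is its highest weight theory, with v as the annihilator of the
    extreme vector.

    Since v is nilpotent and zeta is diagonalizable with eigenvalues in the
    prime field ([Artin_Schreier_split]), M contains m <> 0 with v m = 0 and
    zeta m = c m. The vectors y^s m are zeta-eigenvectors of weight c + s, and v
    sends y^s m to - s (2c + s - 1) / 2 times y^(s-1) m ([string_v]). If i < p
    is the natural number that is - 2c in k, this coefficient vanishes for s = i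
    + 1, so y^(i+1) m generates a submodule contained in y M; as y is nilpotent,
    that submodule is not M, and y^(i+1) m = 0 ([string_simple_end]). Thus M
    contains a ladder m, y m, ..., y^i m on which all generators act by formulas
    that involve i only ([simple_ladder]).

    Conversely these formulas define matrices of size i + 1 that satisfy the
    relations ([standard_mx_eqns]), hence a D(H)-module L_i with a basis that is
    a ladder. It is simple because the coefficients of v between two rungs are
    nonzero: v brings any nonzero vector down to the bottom rung, from which y
    climbs back to the whole basis ([ladder_simple]). Mapping the basis of L_i
    to the ladder of M is a nonzero homomorphism ([ladder_hom]), an isomorphism
    by Schur's lemma, and y^(i+1) = 0 on L_i tells the L_i apart
    ([ladder_isomorphic_le]). *)

(** * The algebra D(H): morphisms out of it and induction on its elements *)

Section FreeLift.
Context (k : fieldType) (I : choiceType) (A : algType k) (f : I -> A).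

Definition word_prod (m : {fmonom I}) : A := \prod_(i <- m) f i.

Lemma word_prod_mmorphism : mmorphism word_prod.
Proof.
by split=> [m1 m2|]; rewrite /word_prod ?fmM ?fm1 ?big_nil ?big_cat.
Qed.

HB.instance Definition _ :=
  isMultiplicative.Build _ _ word_prod word_prod_mmorphism.

Definition free_lift (a : free_alg k I) : A := mmap (in_alg A) word_prod a.

Lemma free_lift_is_zmod_morphism : zmod_morphism free_lift.
Proof. exact: (raddfB (mmap (in_alg A) word_prod)). Qed.

Lemma free_lift_is_monoid_morphism : monoid_morphism free_lift.
Proof.
have comm_alg (g : {malg k[{fmonom I}]}) m m' :
    GRing.comm (in_alg A g@_m) (word_prod m').
  by rewrite /GRing.comm /= mulr_algl mulr_algr.
have [fM f1] := commr_mmap_is_multiplicative comm_alg.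
by split; [exact: f1 | exact: fM].
Qed.

Lemma free_lift_is_scalable : scalable free_lift.
Proof. by move=> c a; rewrite /free_lift mmapZ /= mulr_algl. Qed.

HB.instance Definition _ := GRing.isZmodMorphism.Build (free_alg k I) A
  free_lift free_lift_is_zmod_morphism.
HB.instance Definition _ := GRing.isMonoidMorphism.Build (free_alg k I) A
  free_lift free_lift_is_monoid_morphism.
HB.instance Definition _ := GRing.isScalable.Build k (free_alg k I) A _
  free_lift free_lift_is_scalable.

Lemma free_lift_gen i : free_lift (free_gen k i) = f i.
Proof.
by rewrite /free_lift mmapU /= scale1r mul1r /word_prod fmU big_seq1.
Qed.

End FreeLift.

(** Every element is a combination of words, and a word is a generator times a
    shorter word. *)
Lemma free_alg_ind (k : fieldType) (I : choiceType) (P : free_alg k I -> Prop) :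
  P 1 -> (forall a b, P a -> P b -> P (a + b)) ->
  (forall c a, P a -> P (c *: a)) ->
  (forall i a, P a -> P (free_gen k i * a)) -> forall a, P a.
Proof.
move=> P1 PD PZ PM a; have P0 : P 0 by rewrite -(scale0r 1); apply: PZ.
rewrite (monalgE (a : {malg k[{fmonom I}]})).
apply: (big_ind P) => // m _.
have -> : << a@_m *g m >> = a@_m *: (<< m >> : free_alg k I).
  by apply/malgP => m'; rewrite mcoeffZ !mcoeffU mulrnAr mulr1.
apply: PZ; case: m => s; rewrite -fmE.
elim: s => [|i s IHs].
  by move: P1; congr (P _).
suff -> : (<< fmonom_of_seq fmonom_key (i :: s) >> : free_alg k I) =
   free_gen k i * << fmonom_of_seq fmonom_key s >> by apply: PM.
rewrite [RHS]fgmulUU mulr1; congr << _ >>.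
by apply: val_inj; rewrite /= fmM fmU !fmE.
Qed.

Section QuotLift.
Context (k : fieldType) (A B : algType k) (r : seq A).
Context (r_proper : 1 \notin ideal_gen r) (f : {lrmorphism A -> B}).
Hypothesis f_r : {in r, forall a, f a = 0}.

Lemma qpi_is_zmod_morphism : zmod_morphism (@qpi k A r r_proper).
Proof. exact: raddfB. Qed.
Lemma qpi_is_monoid_morphism : monoid_morphism (@qpi k A r r_proper).
Proof. by split=> // a b; exact: qpiM. Qed.
Lemma qpi_is_scalable : scalable (@qpi k A r r_proper).
Proof. by move=> c a; exact: qpiZ. Qed.
HB.instance Definition _ := GRing.isZmodMorphism.Build A (quot_alg r_proper)
  (@qpi k A r r_proper) qpi_is_zmod_morphism.
HB.instance Definition _ := GRing.isMonoidMorphism.Build A (quot_alg r_proper)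
  (@qpi k A r r_proper) qpi_is_monoid_morphism.
HB.instance Definition _ := GRing.isScalable.Build k A (quot_alg r_proper) _
  (@qpi k A r r_proper) qpi_is_scalable.

(** The proof that f kills the relations is an argument so that the morphism
    instances below can be attached to the function. *)
Definition quot_lift (_ : {in r, forall a, f a = 0})
  (q : quot_alg r_proper) : B := f (qrepr q).
Local Notation lift := (quot_lift f_r).

Lemma quot_lift_qpi a : lift (qpi r_proper a) = f a.
Proof.
have /ideal_genP I := qpi_reprB r_proper a.
apply/eqP; rewrite -subr_eq0 /quot_lift -rmorphB; apply/eqP.
elim: I => [|b /f_r//|b c _ Hb _ Hc|c b _ Hb|c b _ Hb].
- exact: rmorph0.
- by rewrite rmorphD Hb Hc addr0.
- by rewrite rmorphM Hb mulr0.
- by rewrite rmorphM Hb mul0r.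
Qed.

Lemma quot_lift_is_zmod_morphism : zmod_morphism lift.
Proof.
move=> a b; rewrite -[a]qreprK -[b]qreprK -rmorphB !quot_lift_qpi.
exact: rmorphB.
Qed.

Lemma quot_lift_is_monoid_morphism : monoid_morphism lift.
Proof.
split=> [|a b]; first by rewrite quot_lift_qpi rmorph1.
rewrite -[a]qreprK -[b]qreprK -rmorphM !quot_lift_qpi.
exact: rmorphM.
Qed.

Lemma quot_lift_is_scalable : scalable lift.
Proof.
by move=> c a; rewrite -[a]qreprK -linearZ !quot_lift_qpi linearZ.
Qed.

HB.instance Definition _ := GRing.isZmodMorphism.Build (quot_alg r_proper) B
  lift quot_lift_is_zmod_morphism.
HB.instance Definition _ := GRing.isMonoidMorphism.Build (quot_alg r_proper) B
  lift quot_lift_is_monoid_morphism.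
HB.instance Definition _ := GRing.isScalable.Build k (quot_alg r_proper) B _
  lift quot_lift_is_scalable.

End QuotLift.

(** The defining equations are built from algebra operations only; this is what
    transports them from the free algebra to its quotient, and from there to any
    target. *)
Lemma map_dh_eqns (k : fieldType) (p : nat) (A B : algType k)
    (f : {lrmorphism A -> B}) (u v zeta g x y : A) :
  [seq (f e.1, f e.2) | e <- dh_eqns p u v zeta g x y] =
    dh_eqns p (f u) (f v) (f zeta) (f g) (f x) (f y).
Proof.
(* Linearity, restated for the scalar 1/2 viewed in k as a unit ring, which is
   the form in which it occurs in the equations. *)
have fZ a : f (2%:R^-1 *: a) = 2%:R^-1 *: f a by exact: linearZZ.
have fBZ a b: f (a - 2%:R^-1 *: b) = f a - 2%:R^-1 *: f b.
  by rewrite rmorphB [in LHS]/= fZ.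
rewrite /= !fBZ.
by rewrite !(rmorphB f, rmorphD f, rmorphM f, rmorphXn f, rmorph0 f, rmorph1 f).
Qed.

Lemma dh_eqns_nth (k : fieldType) p (A : algType k) (u v zeta g x y : A) n :
  all (fun e => e.1 == e.2) (dh_eqns p u v zeta g x y) ->
  let e := nth (0, 0) (dh_eqns p u v zeta g x y) n in e.1 = e.2.
Proof.
set s := dh_eqns _ _ _ _ _ _ _ => /all_nthP s_hold /=.
have [n_lt|n_ge] := ltnP n (size s); last by rewrite nth_default.
exact/eqP/s_hold.
Qed.

Section DrinfeldDouble.
Context (k : fieldType) (p : nat) (pchar_k : p \in [pchar k]).
Local Notation D := (DH pchar_k).

Definition dh (i : dh_gen) : D := qpi (dh_rels_proper pchar_k) (free_gen k i).

Lemma dh_eqns_hold :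
  all (fun e => e.1 == e.2)
    (dh_eqns p (dh Gu) (dh Gv) (dh Gzeta) (dh Gg) (dh Gx) (dh Gy)).
Proof.
rewrite -[dh_eqns _ _ _ _ _ _ _]map_dh_eqns all_map.
apply/allP => e e_in /=; apply/eqP/qpi_eq/ideal_genP; apply: in_ideal_gen.
exact: (map_f (fun e => e.1 - e.2)).
Qed.

Lemma dh_ind (P : D -> Prop) :
  P 1 -> (forall a b, P a -> P b -> P (a + b)) ->
  (forall c a, P a -> P (c *: a)) ->
  (forall i a, P a -> P (dh i * a)) -> forall a, P a.
Proof.
move=> P1 PD PZ PM a; rewrite -[a]qreprK.
pose pi := qpi (dh_rels_proper pchar_k).
apply: (@free_alg_ind k dh_gen (fun b => P (pi b))).
- by rewrite /pi rmorph1.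
- by move=> b c; rewrite /pi rmorphD; apply: PD.
- by move=> c b; rewrite /pi linearZ; apply: PZ.
- by move=> i b; rewrite /pi rmorphM; apply: PM.
Qed.

Lemma dh_lift (A : algType k) (f : dh_gen -> A) :
  all (fun e => e.1 == e.2)
    (dh_eqns p (f Gu) (f Gv) (f Gzeta) (f Gg) (f Gx) (f Gy)) ->
  exists phi : {lrmorphism D -> A}, forall i, phi (dh i) = f i.
Proof.
move=> f_eqns.
have f_rels : {in dh_rels k p, forall a, free_lift f a = 0}.
  move=> _ /mapP[e e_in ->]; apply/eqP; rewrite rmorphB subr_eq0.
  move: f_eqns; rewrite -!(free_lift_gen f) -map_dh_eqns all_map => /allP.
  exact.
exists (quot_lift (r_proper := dh_rels_proper pchar_k) f_rels) => i.
exact: etrans (quot_lift_qpi _ _ _) (free_lift_gen f i).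
Qed.

End DrinfeldDouble.

(** * Simple modules, and integers in positive characteristic *)

(** Both sides are monic of degree p, and by Fermat's little theorem the p
    distinct elements of the prime field are roots of the left-hand side. *)
Lemma Artin_Schreier_split (k : fieldType) p : p \in [pchar k] ->
  'X^p - 'X = \prod_(j < p) ('X - (j%:R)%:P) :> {poly k}.
Proof.
move=> pchar_k; have p_gt1 := prime_gt1 (pcharf_prime pchar_k).
have size_P : size ('X^p - 'X : {poly k}) = p.+1.
  by rewrite size_polyDl ?size_polyXn // size_polyN size_polyX ltnS.
pose rs : seq k := [seq j%:R | j <- iota 0 p].
rewrite (@all_roots_prod_XsubC _ ('X^p - 'X) rs).
- rewrite lead_coefDl ?size_polyXn ?size_polyN ?size_polyX ?ltnS //.
  rewrite lead_coefXn scale1r big_map.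
  by rewrite -(big_mkord xpredT (fun j => 'X - (j%:R)%:P)) /index_iota subn0.
- by rewrite size_P size_map size_iota.
- apply/allP => _ /mapP[j _ ->]; rewrite rootE !hornerE.
  by rewrite -(pFrobenius_autE pchar_k) pFrobenius_aut_nat subrr.
- rewrite uniq_rootsE map_inj_in_uniq ?iota_uniq // => i j.
  rewrite !mem_iota !add0n.
  wlog le_ij : i j / (i <= j)%N.
    move=> H; have [/H//|/ltnW/H le_ji ip jp ij] := leqP i j.
    by rewrite (le_ji jp ip).
  move=> /= _ j_p /eqP; rewrite eq_sym -subr_eq0 -natrB //.
  rewrite -(dvdn_pcharf pchar_k) => p_dvd.
  apply/eqP; rewrite eqn_leq le_ij /= -subn_eq0 eqn0Ngt.
  apply/negP => /dvdn_leq/(_ p_dvd).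
  by rewrite leqNgt (leq_ltn_trans (leq_subr _ _)).
Qed.

Lemma natr_pchar_neq0 (k : fieldType) p n : p \in [pchar k] ->
  (0 < n < p)%N -> n%:R != 0 :> k.
Proof.
by move=> pchar_k /andP[n_gt0 n_lt]; rewrite -(dvdn_pcharf pchar_k) gtnNdvd.
Qed.

Lemma last_nonzero_power (R : nzRingType) (M : lmodType R) (a : R) n (m : M) :
  a ^+ n *: m = 0 -> m != 0 ->
  exists j, a ^+ j *: m != 0 /\ a ^+ j.+1 *: m = 0.
Proof.
elim: n m => [|n IHn] m; first by rewrite scale1r => ->; rewrite eqxx.
rewrite exprSr -scalerA => an0 m0.
have [am0|am0] := eqVneq (a *: m) 0; first by exists 0%N; rewrite scale1r.
have [j [aj aSj]] := IHn _ an0 am0.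
by exists j.+1; rewrite exprSr -scalerA aj exprSr -scalerA.
Qed.

(** Simplicity as an induction principle: a submodule given by a proposition
    holds everywhere as soon as it holds at one nonzero vector. *)
Lemma simple_module_sub (R : nzRingType) (M : lmodType R) (P : M -> Prop) :
  simple_module M -> P 0 -> (forall m n, P m -> P n -> P (m + n)) ->
  (forall a m, P m -> P (a *: m)) -> forall m0, m0 != 0 -> P m0 ->
  forall m, P m.
Proof.
move=> [_ simple_M] P0 PD PZ m0 m0_neq0 Pm0 m.
have [|S0|ST] := simple_M (fun m => `[< P m >]).
- split=> [|a x y /asboolP Px /asboolP Py]; first exact/asboolP.
  by apply/asboolP/PD => //; apply: PZ.
- move: (S0 m0); rewrite !inE (negPf m0_neq0) => /negP/negP/asboolP.
  by [].
- by move: (ST m); rewrite inE => /asboolP.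
Qed.

Lemma isomorphic_modules_sym (R : nzRingType) (M N : lmodType R) :
  isomorphic_modules M N -> isomorphic_modules N M.
Proof.
move=> [f [g fK Kg]]; have g_lin := can2_linear fK Kg.
pose g' : {linear N -> M} := HB.pack g (GRing.isLinear.Build R N M _ g g_lin).
by exists g'; exists f.
Qed.

(** Schur's lemma: the kernel is a proper submodule, the image a nonzero one. *)
Lemma Schur_isomorphic (R : nzRingType) (M N : lmodType R)
    (f : {linear M -> N}) (m0 : M) :
  simple_module M -> simple_module N -> f m0 != 0 -> isomorphic_modules M N.
Proof.
move=> simple_M simple_N fm0; exists f.
have f_inj : injective f.
  apply: raddf_inj => m fm; apply/eqP/negP => /negP m_neq0.
  have ker_f : forall n, f n = 0.
    apply: (simple_module_sub (P := fun n => f n = 0)) simple_M _ _ _ m m_neq0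
      fm.
    - exact: raddf0.
    - by move=> n n' fn fn'; rewrite raddfD /= fn fn' addr0.
    - by move=> a n fn; rewrite linearZZ fn scaler0.
  by move: fm0; rewrite ker_f eqxx.
have f_onto : forall n, exists m, f m == n.
  apply: simple_module_sub simple_N _ _ _ (f m0) fm0 _.
  - by exists 0; rewrite raddf0.
  - by move=> n n' [m /eqP <-] [m' /eqP <-]; exists (m + m'); rewrite raddfD.
  - by move=> a n [m /eqP <-]; exists (a *: m); rewrite linearZZ.
  - by exists m0.
exists (fun n => xchoose (f_onto n)) => [m|n]; last first.
  exact/eqP/(xchooseP (f_onto n)).
exact/f_inj/eqP/(xchooseP (f_onto (f m))).
Qed.

(** * Reduction to sl2: x, u and g - 1 act by zero on simple modules *)

Section Action.
Context (k : fieldType) (p : nat) (pchar_k : p \in [pchar k]).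
Context (A : algType k) (gen : dh_gen -> A).
Local Notation U := (gen Gu).
Local Notation V := (gen Gv).
Local Notation Z := (gen Gzeta).
Local Notation G := (gen Gg).
Local Notation X := (gen Gx).
Local Notation Y := (gen Gy).

(** All that matters about the algebra is that its generators satisfy the
    relations and that they generate it. *)
Hypothesis gen_rel : all (fun e => e.1 == e.2) (dh_eqns p U V Z G X Y).
Hypothesis gen_ind : forall P : A -> Prop,
  P 1 -> (forall a b, P a -> P b -> P (a + b)) ->
  (forall c a, P a -> P (c *: a)) ->
  (forall i a, P a -> P (gen i * a)) -> forall a, P a.

(* Only these four constants may be unfolded: general reduction would open the
   algebra operations. *)
Local Ltac dh_relation n :=
  by have := dh_eqns_nth n gen_rel;
     cbv beta iota zeta delta [nth dh_eqns fst snd].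

Let g_unip : G ^+ p = 1.
Proof. dh_relation 0%N. Qed.
Let gx : G * X = X * G.
Proof. dh_relation 1%N. Qed.
Let gy : G * Y = Y * G + X * G.
Proof. dh_relation 2%N. Qed.
Let x_nilp : X ^+ p = 0.
Proof. dh_relation 3%N. Qed.
Let y_nilp : Y ^+ p = 0.
Proof. dh_relation 4%N. Qed.
Let yx : Y * X = X * Y - 2%:R^-1 *: X ^+ 2.
Proof. dh_relation 5%N. Qed.
Let z_sep : Z ^+ p = Z.
Proof. dh_relation 6%N. Qed.
Let gz : G * Z = Z * G.
Proof. dh_relation 7%N. Qed.
Let v_nilp : V ^+ p = 0.
Proof. dh_relation 8%N. Qed.
Let u_nilp : U ^+ p = 0.
Proof. dh_relation 9%N. Qed.
Let vu : V * U = U * V - 2%:R^-1 *: U ^+ 2.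
Proof. dh_relation 10%N. Qed.
Let vz : V * Z = Z * V + V.
Proof. dh_relation 11%N. Qed.
Let uz : U * Z = Z * U + U.
Proof. dh_relation 12%N. Qed.
Let zy : Z * Y = Y * Z + Y.
Proof. dh_relation 13%N. Qed.
Let zx : Z * X = X * Z + X.
Proof. dh_relation 14%N. Qed.
Let vg : V * G = G * V + G * U.
Proof. dh_relation 15%N. Qed.
Let ug : U * G = G * U.
Proof. dh_relation 16%N. Qed.
Let vx : V * X = X * V + (1 - G) + X * U.
Proof. dh_relation 17%N. Qed.
Let ux : U * X = X * U.
Proof. dh_relation 18%N. Qed.
Let uy : U * Y = Y * U + (1 - G).
Proof. dh_relation 19%N. Qed.
Let vy : V * Y = Y * V - G * Z + Y * U.
Proof. dh_relation 20%N. Qed.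

Lemma dh_stable (M : lmodType A) (P : M -> Prop) :
  (forall m n, P m -> P n -> P (m + n)) ->
  (forall (c : k) m, P m -> P (c%:A *: m)) ->
  (forall i m, P m -> P (gen i *: m)) ->
  forall (a : A) m, P m -> P (a *: m).
Proof.
move=> PD PZ PM a m Pm; elim/gen_ind: a => [|a b Pa Pb|c a Pa|i a Pa].
- by rewrite scale1r.
- by rewrite scalerDl; apply: PD.
- by rewrite -mulr_algl -scalerA; apply: PZ.
- by rewrite -scalerA; apply: PM.
Qed.

Lemma dh_equivariant (M N : lmodType A) (f : M -> N) :
  {morph f : m n / m + n} ->
  (forall (c : k) m, f (c%:A *: m) = c%:A *: f m) ->
  (forall i m, f (gen i *: m) = gen i *: f m) ->
  forall (a : A) m, f (a *: m) = a *: f m.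
Proof.
move=> fD fZ fM a m; elim/gen_ind: a => [|a b fa fb|c a fa|i a fa].
- by rewrite !scale1r.
- by rewrite !scalerDl fD fa fb.
- by rewrite -mulr_algl -!scalerA fZ fa.
- by rewrite -!scalerA fM fa.
Qed.

Section Module.
Context (M : lmodType A).
Implicit Types (m : M) (c : k).

Lemma scaler_algC a c m : a *: (c%:A *: m) = c%:A *: (a *: m) :> M.
Proof. by rewrite !scalerA mulr_algr mulr_algl. Qed.

Lemma scaler_algA c d m : c%:A *: (d%:A *: m) = (c * d)%:A *: m :> M.
Proof. by rewrite scalerA mulr_algl scalerA. Qed.

Lemma scaler_algDl c d m : (c + d)%:A *: m = c%:A *: m + d%:A *: m :> M.
Proof. by rewrite !scalerDl. Qed.

Lemma scaler_alg1 m : (1%:A : A) *: m = m.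
Proof. by rewrite !scale1r. Qed.

Lemma scaler_alg0 m : (0%:A : A) *: m = 0.
Proof. by rewrite !scale0r. Qed.

Lemma scaler_algN c m : (- c)%:A *: m = - (c%:A *: m) :> M.
Proof. by rewrite !scaleNr. Qed.

(** k acts through the scalars c%:A of the algebra, so this is the k-span. *)
Inductive span (e : nat -> M) : M -> Prop :=
| span0 : span e 0
| spanD m n : span e m -> span e n -> span e (m + n)
| spanZ c m : span e m -> span e (c%:A *: m)
| span_gen s : span e (e s).

Lemma span_stable e : (forall i s, span e (gen i *: e s)) ->
  forall (a : A) m, span e m -> span e (a *: m).
Proof.
move=> e_stable; apply: dh_stable => [m n|c m|i m].
- exact: spanD.
- exact: spanZ.
elim=> [|m1 m2 _ IH1 _ IH2|c m1 _ IH|s].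
- by rewrite scaler0; apply: span0.
- by rewrite scalerDr; apply: spanD.
- by rewrite scaler_algC; apply: spanZ.
- exact: e_stable.
Qed.

(** The last nonzero vector among the a^j m is killed by a. The predicate P
    carries along properties already gained, so that common kernels of commuting
    nilpotent elements are reached one element at a time. *)
Lemma nilpotent_kernel (P : M -> Prop) (a : A) m : a ^+ p = 0 ->
  (forall n, P n -> P (a *: n)) -> P m -> m != 0 ->
  exists n, [/\ P n, n != 0 & a *: n = 0].
Proof.
move=> ap0 Pa Pm m0.
have [|j [aj aSj]] := @last_nonzero_power _ _ a p m _ m0.
  by rewrite ap0 scale0r.
exists (a ^+ j *: m); split=> //; last by rewrite scalerA -exprS.
by elim: {aj aSj}j => [|j IHj]; rewrite ?scale1r // exprS -scalerA; apply: Pa.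
Qed.

Let g1_nilp : (G - 1) ^+ p = 0.
Proof.
have pchar_A : p \in [pchar A] by rewrite pchar_lalg.
have := pFrobenius_autB_comm pchar_A (commr1 G).
by rewrite !pFrobenius_autE g_unip expr1n subrr.
Qed.

Definition augmented m := [/\ X *: m = 0, U *: m = 0 & G *: m = m].

(** The commuting operators x, u and g - 1 are nilpotent, so they have a nonzero
    common kernel, and the relations make it stable under all the generators. *)
Lemma simple_augmented : simple_module M -> forall m, augmented m.
Proof.
move=> simple_M; have [[m m0] _] := simple_M.
have [m1 [_ m1_0 xm1]] :=
  nilpotent_kernel (P := fun=> True) x_nilp (fun _ _ => I) I m0.
have [|m2 [xm2 m2_0 um2]] :=
    nilpotent_kernel (P := fun m => X *: m = 0) u_nilp _ xm1 m1_0.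
  by move=> n xn; rewrite scalerA -ux -scalerA xn scaler0.
have [|m3 [[xm3 um3] m3_0 gm3]] :=
    nilpotent_kernel (P := fun m => X *: m = 0 /\ U *: m = 0) g1_nilp _
      (conj xm2 um2) m2_0.
  move=> n [xn un]; rewrite !scalerBl !scale1r !scalerBr xn un !subr0.
  by rewrite !scalerA -gx ug -!scalerA xn un !scaler0.
have aug_m3 : augmented m3.
  split=> //; apply/eqP.
  by rewrite -subr_eq0 -[X in _ - X]scale1r -scalerBl gm3.
have augD (n n' : M) : augmented n -> augmented n' -> augmented (n + n').
  move=> [xn un gn] [xn' un' gn']; rewrite /augmented !scalerDr.
  by rewrite xn un gn xn' un' gn' addr0.
apply: simple_module_sub simple_M _ _ _ _ m3_0 aug_m3.
- by split; rewrite scaler0.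
- exact: augD.
apply: dh_stable => //.
- by move=> c n [xn un gn]; split; rewrite scaler_algC ?xn ?un ?gn ?scaler0.
move=> i n [xn un gn].
have sqr0 a : a *: n = 0 -> (2%:R^-1 *: a ^+ 2) *: n = 0.
  by move=> an; rewrite -mulr_algl -scalerA expr2 -scalerA an !scaler0.
(* One goal for each generator and each of x, u and g. Only v, zeta and y move
   n; for them, the relation between the two settles the goal. *)
case: i; split.
- by rewrite un scaler0.
- by rewrite un scaler0.
- by rewrite un scaler0.
- have := congr1 (fun a => a *: n) vx.
  rewrite /= !scalerDl !scaleNr scale1r -!scalerA xn un gn.
  by rewrite !scaler0 subrr !addr0 => <-.
- have := congr1 (fun a => a *: n) vu.
  rewrite /= scalerDl scaleNr sqr0 // -!scalerA un scaler0 oppr0 addr0.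
  by move=> <-.
- have := congr1 (fun a => a *: n) vg.
  by rewrite /= scalerDl -!scalerA un gn scaler0 addr0 => <-.
- have := congr1 (fun a => a *: n) zx.
  by rewrite /= scalerDl -!scalerA xn scaler0 addr0 => <-.
- have := congr1 (fun a => a *: n) uz.
  by rewrite /= scalerDl -!scalerA un scaler0 addr0 => <-.
- by rewrite scalerA gz -scalerA gn.
- by rewrite gn.
- by rewrite gn.
- by rewrite gn.
- by rewrite xn scaler0.
- by rewrite xn scaler0.
- by rewrite xn scaler0.
- have := congr1 (fun a => a *: n) yx.
  rewrite /= scalerDl scaleNr sqr0 // -!scalerA xn scaler0 oppr0 addr0.
  by move=> <-.
- have := congr1 (fun a => a *: n) uy.
  rewrite /= !scalerDl !scaleNr scale1r -!scalerA un gn !scaler0 subrr !addr0.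
  by move=> ->.
- have := congr1 (fun a => a *: n) gy.
  by rewrite /= scalerDl -!scalerA gn xn addr0.
Qed.

(** * Strings and ladders of weight vectors *)

Definition weight (i s : nat) : k := s%:R - i%:R / 2%:R.

(** The truncated subtraction makes the coefficient vanish above i + 1 too. *)
Definition lowering (i s : nat) : k := (s * (i.+1 - s))%:R / 2%:R.

(** The weight basis of the simple sl2-module of dimension i + 1, raised by y
    and lowered by v. The sequence is indexed by all natural numbers, with zeros
    from i + 1 on, so that the formulas have no boundary cases: the coefficient
    of v vanishes at the bottom s = 0, where s.-1 is s, and at s = i + 1. *)
Record ladder (i : nat) (e : nat -> M) : Prop := Ladder {
  ladder_aug s : augmented (e s);
  ladder_z s : Z *: e s = (weight i s)%:A *: e s;
  ladder_y s : Y *: e s = e s.+1;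
  ladder_v s : V *: e s = (lowering i s)%:A *: e s.-1;
  ladder_end : e i.+1 = 0 }.

Section Strings.
Hypothesis M_aug : forall m, augmented m.
Hypothesis two_neq0 : 2%:R != 0 :> k.

(** The solution of a(s+1) = a(s) - (c + s) with a(0) = 0, which is the
    recursion that v y = y v - zeta imposes on the coefficients of v along a
    string. *)
Definition string_lowering (c : k) (s : nat) : k :=
  - (s%:R * (c *+ 2 + s%:R - 1) / 2%:R).

Lemma string_z c m : Z *: m = c%:A *: m ->
  forall s, Z *: (Y ^+ s *: m) = (c + s%:R)%:A *: (Y ^+ s *: m).
Proof.
move=> zm; elim=> [|s IHs]; first by rewrite scale1r addr0.
rewrite exprS -scalerA; set e := Y ^+ s *: m in IHs *.
rewrite scalerA zy scalerDl -scalerA IHs scaler_algC -[X in _ + X]scaler_alg1.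
by rewrite -scaler_algDl -addrA natr1.
Qed.

Lemma string_v c m : V *: m = 0 -> Z *: m = c%:A *: m ->
  forall s, V *: (Y ^+ s *: m) = (string_lowering c s)%:A *: (Y ^+ s.-1 *: m).
Proof.
move=> vm zm; have ze := string_z zm; elim=> [|s IHs].
  by rewrite scale1r vm /string_lowering mul0r mul0r oppr0 scaler_alg0.
rewrite exprS -scalerA; set e := Y ^+ s *: m in IHs *.
have [_ ue _] := M_aug e; have [_ _ gze] := M_aug (Z *: e).
set rhs := RHS.
rewrite scalerA vy !scalerDl !scaleNr -!scalerA ue scaler0 addr0 gze ze IHs.
rewrite scaler_algC -/e.
(* At s = 0 the coefficient vanishes, which makes up for s.-1 = 0. *)
have -> : (string_lowering c s)%:A *: (Y *: (Y ^+ s.-1 *: m)) =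
    (string_lowering c s)%:A *: e.
  case: s {IHs ue gze rhs} @e => [|s] e; last by rewrite scalerA -exprS.
  by rewrite /string_lowering mul0r mul0r oppr0 !scaler_alg0.
rewrite -scaler_algN -scaler_algDl {}/rhs; congr ((_ *: _) *: _).
by rewrite /string_lowering -natr1; field.
Qed.

Lemma string_span c m : V *: m = 0 -> Z *: m = c%:A *: m ->
  forall (a : A) n, span (fun s => Y ^+ s *: m) n ->
    span (fun s => Y ^+ s *: m) (a *: n).
Proof.
move=> vm zm; apply: span_stable => i s; have [xe ue ge] := M_aug (Y ^+ s *: m).
have gen_e s' := span_gen (fun s => Y ^+ s *: m) s'.
case: i.
- by rewrite ue; apply: span0.
- by rewrite (string_v vm zm); apply: spanZ.
- by rewrite (string_z zm); apply: spanZ.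
- by rewrite ge.
- by rewrite xe; apply: span0.
- by rewrite scalerA -exprS.
Qed.

(** If y^(j+1) m were a nonzero vector killed by v, the span of its own string
    would be a nonzero submodule, hence M. But that span lies in y M, so y would
    be onto, whereas y is nilpotent. *)
Lemma string_simple_end : simple_module M -> forall c m,
  V *: m = 0 -> Z *: m = c%:A *: m -> forall j,
  V *: (Y ^+ j.+1 *: m) = 0 -> Y ^+ j.+1 *: m = 0.
Proof.
move=> simple_M c m vm zm j v_end; apply/eqP/negP => /negP e_neq0.
have z_end := string_z zm j.+1.
have spanM := simple_module_sub simple_M (span0 _) (@spanD _)
  (string_span v_end z_end) e_neq0.
have Y_onto (n : M) : exists n', n = Y *: n'.
  have {}/spanM : span (fun s => Y ^+ s *: (Y ^+ j.+1 *: m)) (Y ^+ j.+1 *: m).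
    by rewrite -[X in span _ X]scale1r; apply: (span_gen _ 0).
  move=> /(_ n); elim=> [|n1 n2 _ [n1' ->] _ [n2' ->]|d n1 _ [n' ->]|s].
  - by exists 0; rewrite scaler0.
  - by exists (n1' + n2'); rewrite scalerDr.
  - by exists (d%:A *: n'); rewrite scaler_algC.
  - by exists (Y ^+ (s + j) *: m); rewrite !scalerA -exprD -exprS addnS.
have Yp_onto t (n : M) : exists n', n = Y ^+ t *: n'.
  elim: t n => [|t IHt] n; first by exists n; rewrite scale1r.
  have [n' ->] := IHt n; have [n'' ->] := Y_onto n'.
  by exists n''; rewrite scalerA -exprSr.
have [n e_eq] := Yp_onto p (Y ^+ j.+1 *: m).
by move: e_neq0; rewrite e_eq y_nilp scale0r eqxx.
Qed.

(** Apply the factors of the product one by one: the last nonzero vector before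
    the product vanishes is an eigenvector. The kernel of v is not left on the
    way, as v (zeta - j) = (zeta - j + 1) v. *)
Lemma zeta_eigenvector t m : m != 0 -> V *: m = 0 ->
  (\prod_(j < t) (Z - ((j : nat)%:R : k)%:A)) *: m = 0 ->
  exists (j : nat) (n : M),
    [/\ n != 0, V *: n = 0 & Z *: n = (j%:R : k)%:A *: n].
Proof.
elim: t m => [|t IHt] m m0 vm.
  by rewrite big_ord0 scale1r => /eqP/negPn/negP.
rewrite big_ord_recr /= -scalerA.
have [zm _|zm] := eqVneq ((Z - (t%:R : k)%:A) *: m) 0.
  exists t, m; split=> //; apply/eqP.
  by rewrite -subr_eq0 -scaleNr -scalerDl zm.
apply: IHt => //; rewrite scalerDl scaleNr scalerDr scalerN scaler_algC vm.
by rewrite scalerA vz scalerDl -scalerA vm !scaler0 subr0 addr0.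
Qed.

End Strings.

Section Ladders.
Hypothesis p_gt2 : (2 < p)%N.

Let two_neq0 : 2%:R != 0 :> k. Proof. exact: natr_pchar_neq0 pchar_k _. Qed.

Lemma lowering_neq0 i s : (0 < s <= i)%N -> (i < p)%N -> lowering i s != 0.
Proof.
case/andP=> s_gt0 s_le i_lt; rewrite mulf_neq0 ?invr_eq0 // natrM mulf_neq0 //.
  by rewrite (natr_pchar_neq0 pchar_k) // s_gt0 (leq_ltn_trans s_le).
rewrite (natr_pchar_neq0 pchar_k) // subn_gt0 ltnS s_le /=.
by rewrite (leq_ltn_trans _ i_lt) // leq_subLR -add1n leq_add2r.
Qed.

Lemma simple_ladder : simple_module M ->
  exists i e, [/\ (i < p)%N, ladder i e & e 0%N != 0].
Proof.
move=> simple_M; have M_aug := simple_augmented simple_M.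
have [[m0 m0_neq0] _] := simple_M.
have [m1 [_ m1_neq0 vm1]] :=
  nilpotent_kernel (P := fun=> True) v_nilp (fun _ _ => I) I m0_neq0.
have [|j [m [m_neq0 vm zm]]] := @zeta_eigenvector p m1 m1_neq0 vm1.
  have := congr1 (horner_alg Z) (Artin_Schreier_split pchar_k).
  rewrite rmorphB rmorphXn /= horner_algX z_sep subrr rmorph_prod /=.
  under eq_bigr do rewrite rmorphB /= horner_algX horner_algC.
  by move=> <-; rewrite scale0r.
(* p - 2 stands for - 2, so that i is - 2j in k. *)
pose i := ((j * (p - 2)) %% p)%N.
have i_def : i%:R = - (j%:R * 2%:R) :> k.
  have := congr1 (fun n => n%:R : k) (divn_eq (j * (p - 2)) p).
  rewrite natrD !natrM natrB ?(ltnW p_gt2) // (pcharf0 pchar_k) mulr0 !add0r.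
  by rewrite mulrN => <-.
have i_lt : (i < p)%N by rewrite ltn_mod (ltn_trans _ p_gt2).
have end0 : Y ^+ i.+1 *: m = 0.
  apply: (string_simple_end M_aug two_neq0 simple_M vm zm).
  rewrite (string_v M_aug two_neq0 vm zm) /string_lowering -natr1 i_def.
  by rewrite [X in - X](_ : _ = 0) ?oppr0 ?scaler_alg0 //; field.
have end_gt s : (i < s)%N -> Y ^+ s *: m = 0.
  by move=> i_s; rewrite -(subnK i_s) exprD -scalerA end0 scaler0.
exists i, (fun s => Y ^+ s *: m); split; rewrite ?scale1r //; split=> // s.
- rewrite (string_z zm) /weight i_def; congr ((_ *: _) *: _); by field.
- by rewrite scalerA -exprS.
rewrite (string_v M_aug two_neq0 vm zm).
have [s_le|s_gt] := leqP s i.+1; last first.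
  by rewrite (end_gt s.-1) ?scaler0 // -ltnS prednK // (leq_trans _ s_gt).
congr ((_ *: _) *: _); rewrite /string_lowering /lowering.
by rewrite natrM natrB // -[i.+1%:R]natr1 i_def; field.
Qed.

Section OneLadder.
Context (i : nat) (e : nat -> M).
Hypotheses (i_lt : (i < p)%N) (ladder_e : ladder i e).

Lemma ladder_Ypow t s : Y ^+ t *: e s = e (t + s)%N.
Proof.
elim: t => [|t IHt]; first by rewrite scale1r.
by rewrite exprS -scalerA IHt (ladder_y ladder_e).
Qed.

Lemma ladder_gt s : (i < s)%N -> e s = 0.
Proof.
by move=> i_s; rewrite -(subnK i_s) -ladder_Ypow (ladder_end ladder_e) scaler0.
Qed.

Lemma ladder_Vpow_gt t s : (s < t)%N -> V ^+ t *: e s = 0.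
Proof.
elim: t s => [//|t IHt] s; rewrite ltnS exprSr -scalerA (ladder_v ladder_e).
case: s => [|s] s_lt; last by rewrite scaler_algC IHt ?scaler0.
by rewrite /lowering mul0n mul0r scaler_alg0 scaler0.
Qed.

Lemma ladder_Vpow s : (s <= i)%N ->
  exists2 c : k, c != 0 & V ^+ s *: e s = c%:A *: e 0%N.
Proof.
elim: s => [|s IHs] s_le.
  by exists 1; rewrite ?oner_eq0 // scaler_alg1 scale1r.
have [c c0 Vs] := IHs (ltnW s_le).
exists (lowering i s.+1 * c); first by rewrite mulf_neq0 // lowering_neq0.
by rewrite exprSr -scalerA (ladder_v ladder_e) scaler_algC Vs scaler_algA.
Qed.

(** With j the highest index whose coefficient is nonzero, v^j kills all the
    terms but the last, which it sends to a nonzero multiple of e 0. *)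
Lemma ladder_bottom (P : M -> Prop) : (forall (a : A) m, P m -> P (a *: m)) ->
  forall (c : nat -> k) j, (j <= i.+1)%N ->
  P (\sum_(s < j) (c s)%:A *: e s) -> \sum_(s < j) (c s)%:A *: e s != 0 ->
  P (e 0%N).
Proof.
move=> P_stable c; elim=> [|j IHj] j_le; first by rewrite big_ord0 eqxx.
rewrite big_ord_recr /=; have [cj0|cj_neq0] := eqVneq (c j) 0.
  by rewrite cj0 scaler_alg0 addr0; apply: IHj; apply: ltnW.
move=> /(P_stable (V ^+ j)); rewrite scalerDr scaler_sumr big1 => [|s _].
  rewrite add0r scaler_algC; have [d d0 ->] := ladder_Vpow j_le.
  rewrite scaler_algA => /(P_stable ((c j * d)^-1)%:A).
  by rewrite scaler_algA mulVf ?mulf_neq0 // scaler_alg1.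
by rewrite scaler_algC ladder_Vpow_gt ?scaler0.
Qed.

Definition comb (w : 'rV[k]_i.+1) : M := \sum_(s < i.+1) (w 0 s)%:A *: e s.

Lemma combD w1 w2 : comb (w1 + w2) = comb w1 + comb w2.
Proof.
rewrite /comb -big_split; apply: eq_bigr => s _.
by rewrite mxE scaler_algDl.
Qed.

Lemma combZ c w : comb (c *: w) = c%:A *: comb w.
Proof.
rewrite /comb scaler_sumr; apply: eq_bigr => s _.
by rewrite mxE scaler_algA.
Qed.

Lemma comb0 : comb 0 = 0.
Proof. by rewrite -(scale0r 0) combZ scaler_alg0. Qed.

Lemma comb_delta (s : 'I_i.+1) : comb (delta_mx 0 s) = e s.
Proof.
rewrite /comb (bigD1 s) //= big1 => [|t /negPf t_s].
  by rewrite mxE !eqxx addr0 scaler_alg1.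
by rewrite mxE t_s andbF scaler_alg0.
Qed.

Hypothesis comb_bij : bijective comb.

Lemma ladder_neq0 s : (s <= i)%N -> e s != 0.
Proof.
move=> s_le; have s_lt : (s < i.+1)%N by [].
rewrite -[s]/(val (Ordinal s_lt)) -comb_delta -comb0.
rewrite (inj_eq (bij_inj comb_bij)).
apply/eqP => /matrixP/(_ 0 (Ordinal s_lt)); rewrite !mxE !eqxx => /eqP.
by rewrite oner_eq0.
Qed.

(** Every nonzero submodule contains the bottom of the ladder, and y moves the
    bottom to every other basis vector. *)
Lemma ladder_simple : simple_module M.
Proof.
split=> [|S [S0 SL]]; first by exists (e 0%N); apply: ladder_neq0.
have SD m n : m \in S -> n \in S -> m + n \in S.
  by move=> Sm Sn; rewrite -[m]scale1r; apply: SL.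
have SZ (a : A) m : m \in S -> a *: m \in S.
  by move=> Sm; rewrite -[_ *: _]addr0; apply: SL.
have [all0|/existsNP[m /not_implyP[Sm m_neq0]]] :=
  pselect (forall m, m \in S -> m = 0); [left|right] => n.
  by rewrite !inE; apply/idP/eqP => [/all0|->].
have [g gK Kg] := comb_bij; rewrite -[n]Kg inE.
have Se0 : e 0%N \in S.
  have m_comb : m = \sum_(s < i.+1) (g m 0 (inord s))%:A *: e s.
    by rewrite -[LHS]Kg; apply: eq_bigr => s _; rewrite inord_val.
  apply: (ladder_bottom SZ (leqnn _) (c := fun s => g m 0 (inord s))).
    by rewrite -m_comb.
  by rewrite -m_comb; apply/eqP.
apply: (big_ind (fun x => x \in S)) => // s _; apply: (SZ).
by rewrite -(addn0 s) -ladder_Ypow; apply: SZ.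
Qed.

Lemma ladder_dim : has_dim M i.+1.
Proof.
pose f : {linear 'rV[k]_i.+1 -> M | in_alg A \; *:%R} :=
  HB.pack comb (GRing.isSemiAdditive.Build _ _ comb (conj comb0 combD))
    (GRing.isScalable.Build k _ M (in_alg A \; *:%R) comb combZ).
by exists f.
Qed.

Lemma ladder_Ypow_eq0 m : Y ^+ i.+1 *: m = 0.
Proof.
have [g gK Kg] := comb_bij; rewrite -[m]Kg scaler_sumr big1 // => s _.
by rewrite scaler_algC ladder_Ypow ladder_gt ?scaler0 // addSn ltnS leq_addr.
Qed.

End OneLadder.
End Ladders.

End Module.

(** * Comparison of ladders *)

Lemma ladder_gen_agree (M N : lmodType A) i (e : nat -> M) (e' : nat -> N)
    (f : M -> N) : ladder i e -> ladder i e' ->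
  (forall c m, f (c%:A *: m) = c%:A *: f m) -> (forall s, f (e s) = e' s) ->
  forall a s, f (gen a *: e s) = gen a *: e' s.
Proof.
move=> le le' fZ fe; have f0 : f 0 = 0.
  by rewrite -(scaler_alg0 0) fZ scaler_alg0.
case=> s; have [xe ue ge] := ladder_aug le s;
  have [xe' ue' ge'] := ladder_aug le' s.
- by rewrite ue ue'.
- by rewrite (ladder_v le) (ladder_v le') fZ fe.
- by rewrite (ladder_z le) (ladder_z le') fZ fe.
- by rewrite ge ge' fe.
- by rewrite xe xe'.
- by rewrite (ladder_y le) (ladder_y le') fe.
Qed.

(** A basis that is a ladder is universal among ladders of the same length: the
    action of the generators on a ladder is given by formulas that mention i
    only. *)
Lemma ladder_hom (M N : lmodType A) i (e : nat -> M) (e' : nat -> N) :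
  ladder i e -> bijective (@comb M i e) -> ladder i e' ->
  exists f : {linear M -> N}, f (e 0%N) = e' 0%N.
Proof.
move=> le e_bij le'; have [g gK Kg] := e_bij.
pose f m := comb e' (g m).
have f_comb (w : 'rV_i.+1) : f (comb e w) = comb e' w by rewrite /f gK.
have fD : {morph f : m n / m + n}.
  by move=> m n; rewrite -[m]Kg -[n]Kg -combD !f_comb combD.
have fZ (c : k) m : f (c%:A *: m) = c%:A *: f m.
  by rewrite -[m]Kg -combZ !f_comb combZ.
have fe s : f (e s) = e' s.
  have [s_le|s_gt] := ltnP s i.+1.
    by rewrite -[s]/(val (Ordinal s_le)) -!comb_delta f_comb.
  by rewrite !(ladder_gt le, ladder_gt le') // -(comb0 i e) f_comb comb0.
have f0 : f 0 = 0 by rewrite -(comb0 i e) f_comb comb0.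
have f_lin : linear f.
  move=> a m n; rewrite fD; congr (_ + _).
  apply: dh_equivariant => // {}a {}m.
  rewrite -[m]Kg f_comb /comb !scaler_sumr (big_morph f fD f0).
  apply: eq_bigr => s _; rewrite !scaler_algC fZ; congr (_ *: _).
  exact: ladder_gen_agree le le' fZ fe _ _.
pose f' : {linear M -> N} := HB.pack f (GRing.isLinear.Build A M N _ f f_lin).
by exists f'; apply: fe.
Qed.

(** y^(i+1) is zero on M but moves e' 0 to e' (i+1), nonzero if i < j. *)
Lemma ladder_isomorphic_le (M N : lmodType A) i j
    (e : nat -> M) (e' : nat -> N) :
  ladder i e -> bijective (@comb M i e) ->
  ladder j e' -> bijective (@comb N j e') ->
  isomorphic_modules M N -> (j <= i)%N.
Proof.
move=> le e_bij le' e'_bij [f [g fK Kg]].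
rewrite leqNgt; apply/negP => i_lt_j.
have : Y ^+ i.+1 *: e' 0%N = 0.
  by rewrite -[e' _]Kg -linearZZ (ladder_Ypow_eq0 le e_bij) raddf0.
rewrite (ladder_Ypow le') addn0 => /eqP; apply/negP.
exact: ladder_neq0 e'_bij _ i_lt_j.
Qed.

End Action.

(** * Construction of the simple modules *)

Section MatrixModule.
Context (k : fieldType) (R : nzRingType) (n : nat).
Context (phi : {rmorphism R -> 'M[k]_n.+1}).

(** The representation is a dummy argument: it selects the module structure on
    the column vectors. *)
Definition matrix_module (_ : {rmorphism R -> 'M[k]_n.+1}) : Type :=
  'cV[k]_n.+1.
Local Notation V := (matrix_module phi).
HB.instance Definition _ := GRing.Zmodule.on V.

Definition matrix_act (a : R) (w : V) : V := phi a *m w.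

Lemma matrix_actA a b w : matrix_act a (matrix_act b w) = matrix_act (a * b) w.
Proof. by rewrite /matrix_act rmorphM mulmxA. Qed.

Lemma matrix_act1 : left_id 1 matrix_act.
Proof. by move=> w; rewrite /matrix_act rmorph1 mul1mx. Qed.

Lemma matrix_actDr : right_distributive matrix_act +%R.
Proof. by move=> a w1 w2; apply: mulmxDr. Qed.

Lemma matrix_actDl w : {morph matrix_act^~ w : a b / a + b}.
Proof. by move=> a b; rewrite /matrix_act rmorphD mulmxDl. Qed.

HB.instance Definition _ := GRing.Zmodule_isLmodule.Build R V
  matrix_actA matrix_act1 matrix_actDr matrix_actDl.

Lemma matrix_module_scaleE (a : R) (w : V) :
  a *: w = (phi a *m (w : 'cV_n.+1)) :> 'cV[k]_n.+1.
Proof. by []. Qed.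

End MatrixModule.

Section StandardMatrices.
Context (k : fieldType) (p : nat) (pchar_k : p \in [pchar k]).
Context (p_gt2 : (2 < p)%N).
Context (i : nat) (i_lt : (i < p)%N).

(* The s-th basis vector; it is zero above i, which makes the formulas for the
   action of the three matrices valid for all s. *)
Let bcol (s : nat) : 'cV[k]_i.+1 := \col_r (r == s :> nat)%:R.

Definition mxy : 'M[k]_i.+1 := \matrix_(r, t) (r == t.+1 :> nat)%:R.
Definition mxv : 'M[k]_i.+1 :=
  \matrix_(r, t) (lowering k i t *+ (r == t.-1 :> nat)).
Definition mxz : 'M[k]_i.+1 :=
  \matrix_(r, t) (weight k i t *+ (r == t :> nat)).

Lemma mulmx_bcol (F : nat -> nat -> k) s r :
  ((\matrix_(r < i.+1, t < i.+1) F r t) *m bcol s) r 0 =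
    if (s <= i)%N then F r s else 0.
Proof.
rewrite mxE; case: leqP => [s_le|s_gt].
  have s_lt : (s < i.+1)%N by [].
  rewrite (bigD1 (Ordinal s_lt)) //= !mxE eqxx mulr1 big1 ?addr0 // => t.
  by rewrite -val_eqE !mxE /= => /negPf->; rewrite mulr0.
rewrite big1 // => t _; rewrite !mxE ltn_eqF ?mulr0 //.
by apply: leq_trans s_gt; apply: ltn_ord.
Qed.

Lemma bcol_gt s : (i < s)%N -> bcol s = 0.
Proof.
move=> s_gt; apply/colP => r; rewrite !mxE ltn_eqF //.
by apply: leq_trans s_gt; apply: ltn_ord.
Qed.

Lemma mxyE s : mxy *m bcol s = bcol s.+1.
Proof.
apply/colP => r; rewrite (mulmx_bcol (fun r t => (r == t.+1)%:R)) mxE.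
by case: leqP => // s_gt; rewrite ltn_eqF // (leq_trans (ltn_ord r)) // ltnW.
Qed.

Lemma mxvE s : mxv *m bcol s = lowering k i s *: bcol s.-1.
Proof.
apply/colP => r.
rewrite (mulmx_bcol (fun r t => lowering k i t *+ (r == t.-1))) !mxE.
case: leqP => s_gt; first by rewrite mulr_natr.
by rewrite /lowering (eqP (_ : i.+1 - s == 0)%N) ?subn_eq0 // muln0 !mul0r.
Qed.

Lemma mxzE s : mxz *m bcol s = weight k i s *: bcol s.
Proof.
apply/colP => r.
rewrite (mulmx_bcol (fun r t => weight k i t *+ (r == t))) !mxE.
case: leqP => s_gt; first by rewrite mulr_natr.
by rewrite ltn_eqF ?mulr0 // (leq_trans (ltn_ord r)).
Qed.

Lemma eq_mx_bcol (P Q : 'M[k]_i.+1) :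
  (forall s, (s <= i)%N -> P *m bcol s = Q *m bcol s) -> P = Q.
Proof.
move=> PQ; apply/matrixP => r s; have /colP/(_ r) := PQ s (ltn_ord s).
have delta_E : bcol s = delta_mx s 0.
  by apply/colP => t; rewrite !mxE andbT.
by rewrite delta_E -!colE !mxE.
Qed.

Lemma mxyXE t s : mxy ^+ t *m bcol s = bcol (t + s)%N.
Proof.
elim: t => [|t IHt]; first by rewrite mul1mx.
by rewrite exprS -mulmxE -mulmxA IHt mxyE.
Qed.

Lemma mxvXE t s : (s < t)%N -> mxv ^+ t *m bcol s = 0.
Proof.
elim: t s => [//|t IHt] s; rewrite ltnS exprSr -mulmxE -mulmxA mxvE -scalemxAr.
case: s => [|s] s_lt; last by rewrite IHt ?scaler0.
by rewrite /lowering mul0n mul0r scale0r.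
Qed.

Lemma mxzXE t s : mxz ^+ t *m bcol s = weight k i s ^+ t *: bcol s.
Proof.
elim: t => [|t IHt]; first by rewrite mul1mx scale1r.
by rewrite exprS -mulmxE -mulmxA IHt -scalemxAr mxzE scalerA -exprSr.
Qed.

(** Weights lie in the prime field. *)
Lemma weight_pX s : weight k i s ^+ p = weight k i s.
Proof.
rewrite -(pFrobenius_autE pchar_k) /weight rmorphB fmorph_div.
by rewrite !rmorph_nat.
Qed.

Lemma weightS s : weight k i s.+1 = weight k i s + 1.
Proof. by rewrite /weight -natr1 addrAC. Qed.

(** The diagonal entries of the sl2 relation v y = y v - zeta. *)
Lemma loweringS s : (s <= i)%N ->
  lowering k i s.+1 = lowering k i s - weight k i s.
Proof.
move=> s_le; have two_neq0 : 2%:R != 0 :> k by exact: natr_pchar_neq0 pchar_k _.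
rewrite /lowering /weight subSS !natrM !natrB // ?leqW //.
by rewrite -[i.+1%:R]natr1 -[s.+1%:R]natr1; field.
Qed.

(** x, u and g - 1 go to zero, as they must in a simple module. *)
Definition standard_mx (a : dh_gen) : 'M[k]_i.+1 :=
  match a with
  | Gu => 0 | Gv => mxv | Gzeta => mxz | Gg => 1 | Gx => 0 | Gy => mxy
  end.

Lemma standard_mx_eqns : all (fun e => e.1 == e.2)
  (dh_eqns p (standard_mx Gu) (standard_mx Gv) (standard_mx Gzeta)
     (standard_mx Gg) (standard_mx Gx) (standard_mx Gy)).
Proof.
have p_neq0 : (p == 0)%N = false by rewrite -(ltn_predK p_gt2).
have yp : mxy ^+ p = 0.
  apply: eq_mx_bcol => s s_le; rewrite mxyXE mul0mx bcol_gt //.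
  by apply: leq_trans i_lt _; apply: leq_addr.
have vp : mxv ^+ p = 0.
  by apply: eq_mx_bcol => s s_le; rewrite mxvXE ?mul0mx // (leq_ltn_trans s_le).
have zp : mxz ^+ p = mxz.
  by apply: eq_mx_bcol => s s_le; rewrite mxzXE mxzE weight_pX.
have vz : mxv * mxz = mxz * mxv + mxv.
  apply: eq_mx_bcol => s s_le; rewrite mulmxDl -!mulmxE -!mulmxA mxzE mxvE.
  rewrite -!scalemxAr mxvE mxzE !scalerA -scalerDl.
  case: s s_le => [|s] s_le.
    by rewrite /lowering mul0n mul0r !mul0r mulr0 addr0.
  by rewrite weightS /= mulrDl mul1r mulrC.
have zy : mxz * mxy = mxy * mxz + mxy.
  apply: eq_mx_bcol => s s_le; rewrite mulmxDl -!mulmxE -!mulmxA mxzE mxyE.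
  by rewrite -!scalemxAr mxzE mxyE weightS scalerDl scale1r.
have vy : mxv * mxy = mxy * mxv - mxz.
  apply: eq_mx_bcol => s s_le; rewrite mulmxBl -!mulmxE -!mulmxA mxzE mxyE mxvE.
  rewrite mxvE -scalemxAr mxyE (loweringS s_le) scalerBl; congr (_ - _).
  by case: s s_le => // _; rewrite /lowering mul0n mul0r !scale0r.
rewrite /= expr1n !(expr0n, p_neq0) /= subrr.
by rewrite !(yp, vp, zp, vz, zy, vy, mul0r, mulr0, mul1r, mulr1, scaler0,
  oppr0, addr0, add0r) !eqxx.
Qed.

Lemma standard_ladder (A : algType k) (gen : dh_gen -> A)
    (phi : {lrmorphism A -> 'M[k]_i.+1}) :
  (forall a, phi (gen a) = standard_mx a) ->
  exists e : nat -> matrix_module phi,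
    ladder gen i e /\ bijective (@comb k A (matrix_module phi) i e).
Proof.
move=> phi_gen; exists bcol.
have algE (c : k) (w : matrix_module phi) :
    c%:A *: w = (c *: (w : 'cV_i.+1) : 'cV[k]_i.+1) :> matrix_module phi.
  have phi_alg : phi c%:A = c%:A := rmorph_alg phi c.
  by rewrite matrix_module_scaleE [X in X *m _]phi_alg -scalemxAl mul1mx.
have genE a (w : matrix_module phi) :
    gen a *: w = (standard_mx a *m (w : 'cV_i.+1)) :> matrix_module phi.
  by rewrite matrix_module_scaleE [X in X *m _]phi_gen.
split; first split.
- move=> s; split; rewrite genE.
  + exact: mul0mx.
  + exact: mul0mx.
  + exact: mul1mx.
- by move=> s; rewrite genE algE; apply: mxzE.
- by move=> s; rewrite genE; apply: mxyE.
- by move=> s; rewrite genE algE; apply: mxvE.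
- exact: bcol_gt.
have comb_tr (w : 'rV[k]_i.+1) :
    comb (bcol : nat -> matrix_module phi) w = w^T :> 'cV_i.+1.
  rewrite /comb (eq_bigr (fun s : 'I_i.+1 => w 0 s *: bcol s)) => [|s _].
    2: exact: algE.
  apply/colP => r; rewrite [LHS]summxE mxE (bigD1 r) //= !mxE eqxx mulr1.
  rewrite big1 ?addr0 //.
  by move=> s; rewrite eq_sym -val_eqE !mxE => /negPf->; rewrite mulr0.
exists (fun w : matrix_module phi => (w : 'cV_i.+1)^T) => w.
  by rewrite comb_tr trmxK.
by apply: etrans (comb_tr _) _; rewrite trmxK.
Qed.

End StandardMatrices.

Theorem theorem1p11 (k : closedFieldType) (p : nat)
    (pchar_k : p \in [pchar k]) (p_gt2 : (2 < p)%N) :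
  exists L : 'I_p -> lmodType (DH pchar_k),
    [/\ forall i : 'I_p, simple_module (L i),
        forall i j : 'I_p, isomorphic_modules (L i) (L j) -> i = j,
        forall M : lmodType (DH pchar_k),
          simple_module M -> exists i : 'I_p, isomorphic_modules M (L i)
      & forall i : 'I_p, has_dim (L i) i.+1].
Proof.
pose gen := dh pchar_k.
have [L L_ladder] : {L : 'I_p -> lmodType (DH pchar_k) & forall i : 'I_p,
    exists e : nat -> L i, ladder gen i e /\ bijective (@comb k _ (L i) i e)}.
  apply: (@boolp.choice _ _ (fun (i : 'I_p) (L : lmodType (DH pchar_k)) =>
    exists e : nat -> L, ladder gen i e /\ bijective (@comb k _ L i e))) => i.
  have [phi phi_gen] :=
    dh_lift pchar_k (standard_mx_eqns pchar_k p_gt2 (ltn_ord i)).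
  by exists (matrix_module phi); apply: standard_ladder phi_gen.
have L_simple i : simple_module (L i).
  have [e [ladder_e e_bij]] := L_ladder i.
  exact (ladder_simple pchar_k p_gt2 (ltn_ord i) ladder_e e_bij).
exists L; split=> [//|i j L_iso|M simple_M|i].
- have [e [ladder_e e_bij]] := L_ladder i.
  have [e' [ladder_e' e'_bij]] := L_ladder j.
  have le_ji := ladder_isomorphic_le ladder_e e_bij ladder_e' e'_bij.
  have le_ij := ladder_isomorphic_le ladder_e' e'_bij ladder_e e_bij.
  apply/val_inj/eqP; rewrite eqn_leq le_ji // le_ij //.
  exact: isomorphic_modules_sym.
- have [i [e' [i_lt ladder_e' e'_neq0]]] :=
    simple_ladder pchar_k (dh_eqns_hold pchar_k) (@dh_ind _ _ pchar_k) p_gt2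
      simple_M.
  exists (Ordinal i_lt); have [e [ladder_e e_bij]] := L_ladder (Ordinal i_lt).
  have [f fe] := ladder_hom (@dh_ind _ _ pchar_k) ladder_e e_bij ladder_e'.
  apply: isomorphic_modules_sym.
  apply: (Schur_isomorphic (f := f) (m0 := e 0%N)) => //.
  by rewrite fe.
have [e [_ e_bij]] := L_ladder i; exact: ladder_dim e_bij.
Qed.
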